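(* Let $k$ be a positive integer, $D=(V,A)$ a digraph and $\mathcal{L}\subseteq 2^V$ a laminar family containing $V$ and all singletons, such that $D$ contains an $\mathcal{L}$-tight $k$-arborescence. Let $D^+$ be obtained from $D$ by adding a new node $s$ and $|A|+k$ parallel arcs from $s$ to every $v\in V$. For $W\in\mathcal{L}$, let $D_W$ be obtained from $D^+$ by contracting $V+s-W$ to a single node $s_W$ and deleting the arising loops. Then for every $W\in\mathcal{L}$ the family \[\mathcal{B}_W=\{I\subseteq\delta^{out}_{D_W}(s_W): |I|=k \text{ and } I \text{ can be extended to an } \mathcal{L}[W]\text{-tight } s_W\text{-rooted } k\text{-arborescence in } D_W\}\] is the family of bases of a matroid on $\delta^{out}_{D_W}(s_W)$.
   Context: A spanning arborescence is an arc set forming a spanning tree in the undirected sense in which every node has in-degree at most one; a $k$-arborescence is the arc-disjoint union of $k$ spanning arborescences, $s_W$-rooted if all are rooted at $s_W$. For a digraph $H$ and a family $\mathcal{K}$ of node sets, a $k$-arborescence $F$ of $H$ is $\mathcal{K}$-tight if for every $W\in\mathcal{K}$ the arcs of $F$ with both ends in $W$ form a $k$-arborescence of the induced subdigraph $H[W]$. $\mathcal{L}[W]=\{W'\in\mathcal{L}: W'\subseteq W\}$. Arcs of $\delta^{out}_{D_W}(s_W)$ correspond naturally to arcs of $D^+$ entering $W$. *)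

(* Defs.v *)
From mathcomp Require Import all_boot.

Set Implicit Arguments.
Unset Strict Implicit.
Unset Printing Implicit Defensive.

(* Digraphs live in ambient finite types N (nodes) and E (arcs), so that
   subdigraphs and contractions share their arcs with the original digraph.
   Parallel arcs and loops are allowed; src and tgt are meaningful only on
   arcs. *)
Record digraph (N E : finType) := Digraph {
  nodes : {set N};
  arcs : {set E};
  src : E -> N;
  tgt : E -> N;
  arc_ends : forall a, a \in arcs -> (src a \in nodes) && (tgt a \in nodes)
}.

Section Digraphs.
Variables N E : finType.
Implicit Types (H : digraph N E) (F I : {set E}) (X W : {set N}).

Definition delta_out H (r : N) : {set E} :=
  [set a in arcs H | (src H a == r) && (tgt H a != r)].

Definition indeg H F (v : N) : nat := #|[set a in F | tgt H a == v]|.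

Definition arcs_within H F W : {set E} :=
  [set a in F | (src H a \in W) && (tgt H a \in W)].

Lemma induced_ends H W a : a \in arcs_within H (arcs H) W ->
  (src H a \in nodes H :&: W) && (tgt H a \in nodes H :&: W).
Proof.
rewrite !inE => /andP[/arc_ends /andP[sH tH] /andP[sW tW]].
by rewrite sH tH sW tW.
Qed.

Definition induced H W : digraph N E :=
  @Digraph N E (nodes H :&: W) (arcs_within H (arcs H) W) (src H) (tgt H)
    (@induced_ends H W).

(* The node r stands for the node that X is contracted to; it must be an
   element of X or a node outside H. *)
Definition contract_end X (r v : N) : N := if v \in X then r else v.

Definition contract_arcs H X : {set E} :=
  arcs H :\: arcs_within H (arcs H) X.

Lemma contract_ends H X r a : a \in contract_arcs H X ->
  (contract_end X r (src H a) \in r |: (nodes H :\: X)) &&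
  (contract_end X r (tgt H a) \in r |: (nodes H :\: X)).
Proof.
rewrite inE => /andP[_ /arc_ends /andP[sH tH]]; rewrite /contract_end.
by apply/andP; split; case: ifP => vX; rewrite !inE ?eqxx // vX ?sH ?tH orbT.
Qed.

Definition contract H X (r : N) : digraph N E :=
  @Digraph N E (r |: (nodes H :\: X)) (contract_arcs H X)
    (fun a => contract_end X r (src H a))
    (fun a => contract_end X r (tgt H a)) (@contract_ends H X r).

Definition joins H (a : E) (u v : N) : bool :=
  ((src H a == u) && (tgt H a == v)) || ((src H a == v) && (tgt H a == u)).

Definition uconnected H F : Prop :=
  forall u v, u \in nodes H -> v \in nodes H ->
    connect (fun x y => [exists a in F, joins H a x y]) u v.

(* An undirected cycle v_1, a_1, v_2, a_2, ..., v_m, a_m (m >= 1), listed as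
   the pairs (v_i, a_i): a_i joins v_i to v_(i+1), and a_m joins v_m to v_1.
   Loops (m = 1) and pairs of parallel or opposite arcs (m = 2) are cycles. *)
Definition is_ucycle H F (c : seq (N * E)) : Prop :=
  [/\ c <> [::], uniq (unzip1 c), uniq (unzip2 c),
      {subset unzip2 c <= F} &
      cycle (fun p q => joins H p.2 p.1 q.1) c].

Definition spanning_tree H F : Prop :=
  [/\ F \subset arcs H, nodes H != set0, uconnected H F &
      forall c, ~ is_ucycle H F c].

Definition spanning_arborescence H F : Prop :=
  spanning_tree H F /\ forall v, v \in nodes H -> indeg H F v <= 1.

Definition rooted_arborescence H (r : N) F : Prop :=
  [/\ spanning_arborescence H F, r \in nodes H & indeg H F r = 0].

Definition disjoint_union k F (T : 'I_k -> {set E}) : Prop :=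
  (forall i j, i != j -> [disjoint T i & T j]) /\ F = \bigcup_(i < k) T i.

Definition k_arborescence k H F : Prop :=
  exists T : 'I_k -> {set E},
    disjoint_union F T /\ forall i, spanning_arborescence H (T i).

Definition rooted_k_arborescence k H (r : N) F : Prop :=
  exists T : 'I_k -> {set E},
    disjoint_union F T /\ forall i, rooted_arborescence H r (T i).

Definition tight k H (K : {set {set N}}) F : Prop :=
  forall W, W \in K -> k_arborescence k (induced H W) (arcs_within H F W).

Definition laminar (L : {set {set N}}) : Prop :=
  forall X Y, X \in L -> Y \in L ->
    [|| X \subset Y, Y \subset X | [disjoint X & Y]].

Definition matroid_bases (S : {set E}) (B : {set E} -> Prop) : Prop :=
  [/\ forall I, B I -> I \subset S,
      exists I, B I &
      forall I J, B I -> B J -> forall x, x \in I :\: J ->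
        exists2 y, y \in J :\: I & B (y |: (I :\ x))].

End Digraphs.

Section Extension.
Variables (N E : finType) (k : nat) (D : digraph N E).

(* Nodes of D^+: Some v for v in D, and None for the new node s. *)
Definition plus_arc : finType := (E + N * 'I_(#|arcs D| + k))%type.

Definition plus_nodes : {set option N} := None |: (Some @: nodes D).

Definition plus_arcs : {set plus_arc} :=
  [set e : plus_arc | match e with
                      | inl a => a \in arcs D
                      | inr (v, _) => v \in nodes D
                      end].

Definition plus_src (e : plus_arc) : option N :=
  match e with inl a => Some (src D a) | inr _ => None end.

Definition plus_tgt (e : plus_arc) : option N :=
  match e with inl a => Some (tgt D a) | inr (v, _) => Some v end.

Lemma plus_ends e : e \in plus_arcs ->
  (plus_src e \in plus_nodes) && (plus_tgt e \in plus_nodes).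
Proof.
have SomeP v : (Some v \in plus_nodes) = (v \in nodes D).
  by rewrite !inE mem_imset // => ? ? [].
rewrite inE; case: e => [a|[v i]] /=; rewrite ?SomeP; first exact: arc_ends.
by move=> ->; rewrite !inE eqxx.
Qed.

Definition plus : digraph (option N) plus_arc :=
  @Digraph (option N) plus_arc plus_nodes plus_arcs plus_src plus_tgt plus_ends.

(* D_W; the contracted node s_W is again represented by None. *)
Definition DW (W : {set N}) : digraph (option N) plus_arc :=
  contract plus (nodes plus :\: (Some @: W)) None.

(* L[W], as a family of node sets of D_W. *)
Definition restr (L : {set {set N}}) (W : {set N}) : {set {set option N}} :=
  [set Some @: (W' : {set N}) | W' : {set N} in L & W' \subset W].

Definition BW (L : {set {set N}}) (W : {set N}) (I : {set plus_arc}) : Prop :=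
  [/\ I \subset delta_out (DW W) None, #|I| = k &
      exists F : {set plus_arc},
        [/\ I \subset F, rooted_k_arborescence k (DW W) None F &
            tight k (DW W) (restr L W) F]].

End Extension.

(* Main.v *)
Require Import Defs.
From mathcomp Require Import all_boot zify.

(* Counting arcs, [F] is an L[W]-tight rooted k-arborescence of D_W exactly when
   the set [B] of its arcs inside W satisfies [i_B(X) <= k|X| - k] for all
   nonempty [X], with equality on L[W], and every node v of W has
   [k - indeg_B(v)] root arcs: Edmonds' disjoint arborescences theorem gives one
   direction.  So [I] is in B_W iff its numbers of arcs into the nodes of W are
   [k - indeg_B] for such a [B].  The sets [B] are the bases of a face of a count
   matroid, their exchange property carries over to the vectors of indegrees, and
   from there to the sets [I], in which arcs with the same head are
   interchangeable. *)

Set Implicit Arguments.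
Unset Strict Implicit.
Unset Printing Implicit Defensive.

(** * Counting by sums, and cycles of a self-map *)

Lemma card_sep_sum (T : finType) (F : {set T}) (P : pred T) :
  #|[set a in F | P a]| = \sum_(a in F) P a.
Proof.
rewrite -sum1_card big_mkcond [RHS]big_mkcond /=; apply: eq_bigr => a _.
by rewrite !inE; case: (a \in F); case: (P a).
Qed.

(** The orbit of [x] runs back into itself at some index [i]; from there on it is a cycle. *)
Lemma fcycle_ex (T : finType) (f : T -> T) (x : T) :
  exists s, [/\ s <> [::], uniq s, fcycle f s & {subset s <= orbit f x}].
Proof.
have /trajectP[i lt_i eq_i] := looping_order f x.
set n := order f x in lt_i eq_i.
exists (drop i (orbit f x)).
have -> : drop i (orbit f x) = traject f (iter i f x) (n - i).
  rewrite /orbit -/n -{1}(subnKC (ltnW lt_i)) trajectD drop_size_cat //.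
  by rewrite size_traject.
split.
- by rewrite -[n - i]prednK ?subn_gt0.
- have := orbit_uniq f x.
  by rewrite /orbit -/n -{1}(subnKC (ltnW lt_i)) trajectD cat_uniq => /and3P[].
- rewrite -[n - i]prednK ?subn_gt0 //= rcons_path fpath_traject /=.
  rewrite last_traject -iterS prednK ?subn_gt0 // -iterD subnK ?(ltnW lt_i) //.
  by rewrite eq_i.
- move=> y ys; rewrite /orbit -/n -{1}(subnKC (ltnW lt_i)) trajectD mem_cat.
  by rewrite ys orbT.
Qed.

(** * Arborescences through in-degrees and cuts *)

Section Digraph.
Variables (N E : finType) (H : digraph N E).
Implicit Types (F T : {set E}) (X Y Z : {set N}).

Definition inside X (a : E) : bool := (src H a \in X) && (tgt H a \in X).

Definition enters X (a : E) : bool := (src H a \notin X) && (tgt H a \in X).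

Definition entering F X : {set E} := [set a in F | enters X a].

Lemma card_indeg F v : indeg H F v = \sum_(a in F) (tgt H a == v).
Proof. exact: card_sep_sum. Qed.

Lemma card_arcs_within F X : #|arcs_within H F X| = \sum_(a in F) inside X a.
Proof. exact: card_sep_sum. Qed.

Lemma card_entering F X : #|entering F X| = \sum_(a in F) enters X a.
Proof. exact: card_sep_sum. Qed.

(** An arc with head in [X] either enters [X] or lies inside it. *)
Lemma sum_indeg F X :
  \sum_(v in X) indeg H F v = #|entering F X| + #|arcs_within H F X|.
Proof.
rewrite card_entering card_arcs_within -big_split /=.
under eq_bigr do rewrite card_indeg.
rewrite exchange_big /=; apply: eq_bigr => a _.
have -> : \sum_(v in X) ((tgt H a == v) : nat) = (tgt H a \in X).
  rewrite big_mkcond (bigD1 (tgt H a)) //= eqxx big1 ?addn0; first by case: ifP.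
  by move=> v /negPf; rewrite eq_sym => ->; case: ifP.
by rewrite /enters /inside; case: (_ \in X); case: (_ \in X).
Qed.

Lemma tgt_inj_in F : F \subset arcs H ->
    (forall v, v \in nodes H -> indeg H F v <= 1) ->
  {in F &, injective (tgt H)}.
Proof.
move=> sF le1 a b aF bF eq_ab.
have /andP[_ tH] := arc_ends (subsetP sF _ aF).
have /card_le1_eqP := le1 _ tH; apply; rewrite inE ?aF ?bF /= ?eqxx //.
by rewrite eq_ab.
Qed.

Lemma joinsC a u v : joins H a u v = joins H a v u.
Proof. by rewrite /joins orbC. Qed.

Lemma uadj_sym F : symmetric (fun x y => [exists a in F, joins H a x y]).
Proof. by move=> x y /=; apply: eq_existsb => a; rewrite joinsC. Qed.

(** The nodes not reachable from [r] would form a set that no arc of [T] enters, so [T] is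
    connected. Since heads are distinct, the heads of the arcs of a cycle are exactly its nodes; an
    arc of [T] entering this node set would share its head with a cycle arc, hence be that arc,
    whose tail lies in the set too. *)
Lemma rooted_arborescence_cut (r : N) T :
    T \subset arcs H -> r \in nodes H ->
    (forall v, v \in nodes H -> indeg H T v <= 1) -> indeg H T r = 0 ->
    (forall X, X \subset nodes H -> X != set0 -> r \notin X ->
       exists2 a, a \in T & enters X a) ->
  rooted_arborescence H r T.
Proof.
move=> sT rH le1 r0 cutT.
have inj := tgt_inj_in sT le1.
have csym := sym_connect_sym (uadj_sym T).
set e := (fun x y => _) in csym.
have conn_r v : v \in nodes H -> connect e r v.
  move=> vH; apply/negPn/negP => nrv.
  have [|||a aT /andP[sX]] := cutT [set v in nodes H | ~~ connect e r v].
  - by apply/subsetP => x; rewrite inE => /andP[].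
  - by apply/set0Pn; exists v; rewrite inE vH.
  - by rewrite inE connect0 andbF.
  have /andP[sH tH] := arc_ends (subsetP sT _ aT).
  rewrite inE tH => /negP; apply.
  move: sX; rewrite inE sH /= negbK => /connect_trans; apply.
  by apply/connect1/existsP; exists a; rewrite aT /joins !eqxx.
do 3 split => //.
- by apply/set0Pn; exists r.
- by move=> u v uH vH; apply: (connect_trans _ (conn_r v vH)); rewrite csym conn_r.
move=> c [c0 u1 u2 sc cyc].
pose X := [set v in unzip1 c]; pose C := [set a in unzip2 c].
have cardX : #|X| = size c by rewrite cardsE (card_uniqP u1) size_map.
have cardC : #|C| = size c by rewrite cardsE (card_uniqP u2) size_map.
have CX a : a \in C -> inside X a.
  rewrite inE => /mapP[p pc ->]; have := next_cycle cyc pc.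
  have pX : p.1 \in X by rewrite inE map_f.
  have qX : (next c p).1 \in X by rewrite inE map_f // mem_next.
  by rewrite /inside => /orP[] /andP[/eqP-> /eqP->]; rewrite ?pX ?qX.
have CT a : a \in C -> a \in T by rewrite inE => /sc.
have XH : X \subset nodes H.
  apply/subsetP => v; rewrite inE => /mapP[p pc ->].
  have /CT/(subsetP sT)/arc_ends/andP[sH tH] : p.2 \in C by rewrite inE map_f.
  by have := next_cycle cyc pc => /orP[] /andP[/eqP es /eqP et]; rewrite -?es -?et.
have tgtC : tgt H @: C = X.
  apply/eqP; rewrite eqEcard cardX -cardC card_in_imset; last first.
    by move=> a b aC bC; apply: inj; apply: CT.
  rewrite leqnn andbT; apply/subsetP => _ /imsetP[a /CX/andP[_ aX] ->] //.
have rX : r \notin X.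
  rewrite -tgtC; apply/imsetP => -[a /CT aT ra].
  have : a \in [set a in T | tgt H a == r] by rewrite inE aT ra eqxx.
  by move/eqP: r0; rewrite cards_eq0 => /eqP->; rewrite inE.
have X0 : X != set0.
  by rewrite -card_gt0 cardX; case: (c) c0.
have [a aT /andP[sX tX]] := cutT X XH X0 rX.
move: tX; rewrite -tgtC => /imsetP[b bC /(inj _ _ aT (CT _ bC)) ab].
by move: sX; rewrite ab; have /andP[->] := CX b bC.
Qed.

(** With [#|X|] arcs inside, every node of [X] would be the head of one of them, heads being
    distinct. Going from each node to the tail of that arc maps [X] to itself, and a cycle of this
    map is an undirected cycle of [T]. *)
Lemma arborescence_within_lt T X : spanning_arborescence H T ->
  X \subset nodes H -> X != set0 -> #|arcs_within H T X| < #|X|.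
Proof.
move=> [[sT _ _ acyc] le1] XH /set0Pn[x xX]; rewrite ltnNge; apply/negP => leX.
have inj := tgt_inj_in sT le1.
have WT a : a \in arcs_within H T X -> a \in T by rewrite inE => /andP[].
have tgtW : tgt H @: arcs_within H T X = X.
  apply/eqP; rewrite eqEcard card_in_imset ?leX ?andbT.
    by apply/subsetP => _ /imsetP[a + ->]; rewrite inE => /and3P[].
  by move=> a b aC bC; apply: inj; apply: WT.
(* [a0] is the default value that makes the choice [p] of an incoming arc total. *)
have [a0 _ _] : exists2 a, a \in arcs_within H T X & x = tgt H a.
  by apply/imsetP; rewrite tgtW.
pose p v := odflt a0 [pick a in arcs_within H T X | tgt H a == v].
have pP v : v \in X -> p v \in arcs_within H T X /\ tgt H (p v) = v.
  rewrite -{1}tgtW => /imsetP[a aW va]; rewrite /p; case: pickP => /= [b /andP[bW /eqP]|/(_ a)].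
    by [].
  by rewrite aW va eqxx.
pose f v := src H (p v).
have fX v : v \in X -> f v \in X.
  by move=> /pP[]; rewrite inE => /and3P[].
have [s [s0 us cs sub]] := fcycle_ex f x.
have sX v : v \in s -> v \in X.
  move/sub; rewrite /orbit => /trajectP[i _ ->].
  by elim: i => //= i; apply: fX.
apply: (acyc [seq (v, p v) | v <- s]); split.
- by case: (s) s0.
- by rewrite /unzip1 -map_comp map_id.
- rewrite /unzip2 -map_comp map_inj_in_uniq // => u v /sX/pP[_ eu] /sX/pP[_ ev] /= e.
  by rewrite -eu -ev e.
- move=> a; rewrite /unzip2 -map_comp => /mapP[v /sX/pP[/WT vT _] ->] //.
(* The arc [p u] runs from [f u] to [u]: the cycle is traversed against its arcs, whence the second
   alternative of [joins]. *)
- apply: (@homo_cycle_in _ _ (mem s) (fun v => (v, p v)) (frel f)) cs; last exact/allP.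
  move=> u v us' _ /eqP <-; rewrite /joins /=.
  by have [_ ->] := pP u (sX _ us'); rewrite !eqxx orbT.
Qed.

(* The set reachable from a source [u] is closed under adjacency, hence it is
   the whole node set; so a second source is reachable from [u]. *)
Lemma arborescence_source_uniq T u v : spanning_arborescence H T ->
  u \in nodes H -> v \in nodes H -> indeg H T u = 0 -> indeg H T v = 0 -> u = v.
Proof.
move=> [[sT _ conn _] le1] uH vH u0 v0.
have inj := tgt_inj_in sT le1.
have src0 w a : indeg H T w = 0 -> a \in T -> tgt H a != w.
  move=> w0 aT; apply/eqP => aw.
  have : a \in [set a in T | tgt H a == w] by rewrite inE aT aw eqxx.
  by move/eqP: w0; rewrite cards_eq0 => /eqP->; rewrite inE.
pose d := [rel x y | [exists a in T, (src H a == x) && (tgt H a == y)]].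
have step x y : connect d u x -> [exists a in T, joins H a x y] -> connect d u y.
  move=> ux /existsP[a /andP[aT /orP[]/andP[/eqP ea /eqP eb]]].
    by apply: connect_trans ux _; apply/connect1/existsP; exists a; rewrite aT ea eb !eqxx.
  (* Now [a] leads from [y] to [x]. The path to [x] is not empty, as [u] is a source, and its last
     arc has the same head as [a], hence is [a]; so the path passes through [y]. *)
  case/connectP: ux => p; case/lastP: p => [|p z] /=.
    by move=> _ xu; have := src0 _ _ u0 aT; rewrite eb xu eqxx.
  rewrite rcons_path last_rcons => /andP[dp /existsP[b /and3P[bT /eqP bs /eqP bt]]] xz.
  have ab : a = b by apply: inj => //; rewrite eb bt xz.
  by rewrite -ea ab bs; apply/connectP; exists p.
have : connect d u v.
  case/connectP: (conn u v uH vH) => p; elim/last_ind: p v {vH v0} => [|p z IH] v /=.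
    by move=> _ ->.
  rewrite rcons_path last_rcons => /andP[dp dz] ->.
  exact: step (IH _ dp erefl) dz.
case/connectP => p; case/lastP: p => [|p z] //=.
rewrite rcons_path last_rcons => /andP[_ /existsP[b /and3P[bT _ /eqP bt]]] vz.
by have := src0 _ _ v0 bT; rewrite bt vz eqxx.
Qed.

(** One inequality is [arborescence_within_lt] on the whole node set. For the other, nodes that are
    not heads are sources, and there is at most one source. *)
Lemma card_arborescence T : spanning_arborescence H T -> #|T|.+1 = #|nodes H|.
Proof.
move=> aT; have [[sT H0 _ _] _] := aT.
have sTn a : a \in T -> inside (nodes H) a by move/(subsetP sT)/arc_ends.
have := arborescence_within_lt aT (subxx _) H0.
have -> : arcs_within H T (nodes H) = T.
  by apply/setP => a; rewrite inE; case aT': (a \in T); rewrite // -/(inside _ _) sTn.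
move=> lt; apply/eqP; rewrite eqn_leq lt /=.
have : #|nodes H :\: (tgt H @: T)| <= 1.
  apply/card_le1_eqP => u v; rewrite !inE => /andP[uT uH] /andP[vT vH].
  have src0 w : w \notin tgt H @: T -> indeg H T w = 0.
    move=> wT; apply/eqP; rewrite cards_eq0; apply/eqP/setP => a; rewrite !inE.
    by apply/andP => -[aT' /eqP aw]; rewrite -aw imset_f in wT.
  by apply: (arborescence_source_uniq aT vH uH); apply: src0.
have := leq_imset_card (tgt H) T; have := cardsID (tgt H @: T) (nodes H).
have := subset_leq_card (subsetIr (nodes H) (tgt H @: T)).
by lia.
Qed.

End Digraph.

(** * Edmonds' disjoint arborescences theorem *)

Section Edmonds.
Variables (N E : finType) (H : digraph N E) (r : N).
Implicit Types (F T : {set E}) (X Y Z U : {set N}).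

Lemma entering_submod F X Z :
  #|entering H F (X :&: Z)| + #|entering H F (X :|: Z)| <=
  #|entering H F X| + #|entering H F Z|.
Proof.
rewrite !card_entering -!big_split; apply: leq_sum => a _.
by rewrite /enters !inE; do 4!case: (_ \in _).
Qed.

Let W := nodes H :\ r.

Let inW x : (x \in W) = (x != r) && (x \in nodes H).
Proof. by rewrite /W !inE. Qed.

(** State of the greedy construction of one arborescence: [T] spans [r |: U] from [r], and the arcs
    it leaves over still satisfy the cut condition for [k] further arborescences. *)
Definition grown F k U T : Prop :=
  [/\ T \subset F, U \subset W,
      forall a, a \in T -> src H a \in r |: U,
      forall v, indeg H T v = (v \in U) &
      (forall X, X \subset U -> X != set0 -> exists2 a, a \in T & enters H X a)
      /\ (forall X, X \subset W -> X != set0 -> k <= #|entering H (F :\: T) X|)].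

(* Lovász: a minimal set [X], among those not inside [U] that the remaining
   arcs enter only [k] times, is entered within itself at [X :\: U]; such an
   arc can be spent, by submodularity and minimality. *)
Lemma grow_step F k U T : F \subset arcs H ->
    (forall X, X \subset W -> X != set0 -> k.+1 <= #|entering H F X|) ->
    grown F k U T -> U != W ->
  exists v a, v \in W :\: U /\ grown F k (v |: U) (a |: T).
Proof.
move=> FH cutF [sTF sUW srcT degT [cutT cutR]] neqUW.
have TU a : a \in T -> tgt H a \in U.
  move=> aT; have : 0 < indeg H T (tgt H a).
    by rewrite card_gt0; apply/set0Pn; exists a; rewrite inE aT eqxx.
  by rewrite degT lt0b.
have enter_disj X : X \subset W -> X != set0 -> [disjoint X & U] ->
    k.+1 <= #|entering H (F :\: T) X|.
  move=> sX X0 dX; rewrite (leq_trans (cutF _ sX X0)) //.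
  apply/subset_leq_card/subsetP => a; rewrite !inE => /andP[aF aX].
  rewrite aF aX !andbT; apply/negP => /TU; case/andP: aX => _ aX.
  by rewrite (disjointFr dX aX).
(* Sets in [crit] have no entering arc to spare: the next arc must lead from [r |: U] to a new node
   and enter none of them. *)
pose crit X := [&& X \subset W, ~~ (X \subset U) & #|entering H (F :\: T) X| == k].
have [a [aF aT aU aWU safe]] : exists a, [/\ a \in F, a \notin T,
    src H a \in r |: U, tgt H a \in W :\: U &
    forall Z, crit Z -> ~~ enters H Z a].
  have [/existsP[X0 critX0]|/existsPn nocrit] := boolP [exists X, crit X]; last first.
    (* Without critical sets any remaining arc entering [W :\: U] is safe; there is one because no
       arc of [T] has its head there. *)
    have WU0 : W :\: U != set0.
      by rewrite setD_eq0; apply: contraNN neqUW => sWU; rewrite eqEsubset sUW.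
    have sWU : W :\: U \subset W by apply: subsetDl.
    have dWU : [disjoint W :\: U & U].
      by rewrite disjoints_subset setDE subsetIr.
    have /(leq_trans _) := enter_disj _ sWU WU0 dWU.
    move/(_ 1 isT); rewrite card_gt0 => /set0Pn[a].
    rewrite inE inE => /andP[/andP[aT aF] /andP[sa ta]].
    exists a; split=> // [|Z]; last by rewrite (negPf (nocrit Z)).
    have /andP[sH _] := arc_ends (subsetP FH _ aF).
    by move: sa; rewrite in_setU1 in_setD inW sH; case: (_ == r) => //=; case: (_ \in U).
  case: (arg_minnP (fun X : {set N} => #|X|) critX0) => X /and3P[XW XU /eqP Xk] minX.
  have XU0 : X :\: U != set0 by rewrite setD_eq0.
  have sXUW : X :\: U \subset W by apply: subset_trans (subsetDl _ _) XW.
  have dXU : [disjoint X :\: U & U].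
    by rewrite disjoints_subset setDE subsetIr.
  have := enter_disj _ sXUW XU0 dXU; rewrite -Xk ltnNge => nle.
  have : ~~ (entering H (F :\: T) (X :\: U) \subset entering H (F :\: T) X).
    by apply: contraNN nle; apply: subset_leq_card.
  case/subsetPn => a; rewrite inE inE => /andP[/andP[aT aF] /andP[sa ta]].
  move: ta; rewrite inE => /andP[tU tX].
  rewrite inE inE aT aF /= /enters tX andbT negbK => sX.
  move: sa; rewrite inE sX andbT negbK => sU.
  exists a; split=> //; first by rewrite !inE sU orbT.
    by rewrite inE tU (subsetP XW).
  move=> Z /and3P[ZW ZU /eqP Zk]; apply/negP => /andP[sZ tZ].
  have XZ : crit (X :&: Z).
    apply/and3P; split; first by apply: subset_trans (subsetIl _ _) XW.
      by apply/subsetPn; exists (tgt H a); rewrite // inE tX.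
    rewrite eqn_leq; apply/andP; split; last first.
      apply: cutR; first by apply: subset_trans (subsetIl _ _) XW.
      by apply/set0Pn; exists (tgt H a); rewrite inE tX.
    have := entering_submod (F :\: T) X Z; rewrite Xk Zk.
    have : k <= #|entering H (F :\: T) (X :|: Z)|.
      apply: cutR; first by rewrite subUset XW.
      by apply/set0Pn; exists (tgt H a); rewrite inE tX.
    move=> kU leS; rewrite -(leq_add2r k); apply: leq_trans leS.
    by rewrite leq_add2l.
  have := minX _ XZ; rewrite leqNgt => /negP; apply; apply: proper_card.
  rewrite properE subsetIl; apply/subsetPn; exists (src H a) => //.
  by rewrite inE sX (negPf sZ).
have [tU tW] : tgt H a \notin U /\ tgt H a \in W by move: aWU; rewrite inE => /andP[].
have sta : src H a != tgt H a.
  apply: contraTneq aU => ->; rewrite in_setU1 (negPf tU) orbF.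
  by move: tW; rewrite inW => /andP[].
exists (tgt H a), a; split=> //; split.
- by rewrite subUset sub1set aF.
- by rewrite subUset sub1set tW.
- move=> b; rewrite !inE => /orP[/eqP->|/srcT]; last first.
    by rewrite !inE => /orP[->|->]; rewrite ?orbT.
  by move: aU; rewrite !inE => /orP[->|->]; rewrite ?orbT.
- move=> v; rewrite card_indeg big_setU1 //= -card_indeg degT !inE eq_sym.
  by case: eqVneq => // ->; rewrite (negPf tU).
split=> [X sX X0|X sX X0].
  have [XU|nXU] := boolP (X :\ tgt H a == set0).
    have Xa : X = [set tgt H a].
      apply/eqP; rewrite eqEsubset sub1set -setD_eq0 XU.
      have /set0Pn[x xX] := X0.
      move: XU; rewrite setD_eq0 => /subsetP/(_ _ xX); rewrite inE => /eqP <- //.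
    by exists a; rewrite ?setU11 // /enters Xa !inE sta eqxx.
  have sXU : X :\ tgt H a \subset U by rewrite subDset.
  have [b bT /andP[sb tb]] := cutT _ sXU nXU.
  exists b; first by rewrite inE bT orbT.
  move: tb; rewrite /enters !inE => /andP[_ ->]; rewrite andbT.
  move: sb; rewrite !inE negb_and negbK => /orP[/eqP sb|//].
  have := srcT _ bT; rewrite sb in_setU1 (negPf tU) orbF.
  by move: tW; rewrite inW => /andP[/negPf->].
(* Only a set entered by [a] loses an arc. It contains the new node, so it is not inside [U]; not
   being critical, it was entered more than [k] times. *)
have [aX|naX] := boolP (enters H X a); last first.
  rewrite (leq_trans (cutR _ sX X0)) //; apply/subset_leq_card/subsetP => b.
  rewrite !inE => /andP[/andP[bT ->] bX]; rewrite bX negb_or bT !andbT /=.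
  by apply: contraTneq bX => ->.
have XU : ~~ (X \subset U).
  by apply/subsetPn; exists (tgt H a) => //; case/andP: aX.
have : k != #|entering H (F :\: T) X|.
  apply/negP => /eqP Xk; have := safe X; rewrite aX /crit sX XU -Xk eqxx.
  by move/(_ isT).
have := cutR _ sX X0; rewrite leq_eqVlt => /orP[->//|lt _].
have : entering H (F :\: T) X :\ a \subset entering H (F :\: (a |: T)) X.
  apply/subsetP => b; rewrite !inE negb_or => /andP[->] /andP[/andP[-> ->] ->] //.
move/subset_leq_card; apply: leq_trans.
have aFX : a \in entering H (F :\: T) X by rewrite inE inE aT aF.
by rewrite -ltnS (leq_trans lt) // (cardsD1 a) aFX.
Qed.

Lemma arborescence_ex F k : F \subset arcs H ->
    (forall X, X \subset W -> X != set0 -> k.+1 <= #|entering H F X|) ->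
  exists T, grown F k W T.
Proof.
move=> FH cutF.
have g0 : grown F k set0 set0.
  split; rewrite ?sub0set //.
  - by move=> a; rewrite inE.
  - by move=> v; rewrite card_indeg big_set0 inE.
  split=> X; first by rewrite subset0 => /eqP->; rewrite eqxx.
  by move=> XW X0; rewrite setD0 ltnW ?cutF.
suff grow n U T : #|W :\: U| <= n -> grown F k U T -> exists T', grown F k W T'.
  exact: grow (leqnn _) g0.
elim: n U T => [|n IH] U T leN gU; have [eUW|neUW] := eqVneq U W.
- by exists T; rewrite -eUW.
- case: gU => _ sUW _ _ _; case/negP: neUW; rewrite eqEsubset sUW -setD_eq0.
  by rewrite -cards_eq0 -leqn0.
- by exists T; rewrite -eUW.
have [v [a [vWU gU']]] := grow_step FH cutF gU neUW.
apply: IH gU'; rewrite -ltnS; apply: leq_trans leN.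
rewrite [ltnRHS](cardsD1 v) vWU add1n ltnS.
by rewrite setDDl setUC.
Qed.

(** Each round splits off one arborescence and keeps the cut condition for the rest. The in-degrees
    off the root drop by exactly one each time, so that no arc of [F] remains at the end. *)
Theorem edmonds_disjoint_arborescences k F : r \in nodes H -> F \subset arcs H ->
    (forall v, v \in nodes H -> indeg H F v = (v != r) * k) ->
    (forall X, X \subset W -> X != set0 -> k <= #|entering H F X|) ->
  rooted_k_arborescence k H r F.
Proof.
move=> rH; elim: k F => [|k IH] F FH degF cutF.
  have F0 : F = set0.
    apply/eqP; rewrite -subset0; apply/subsetP => a aF.
    have /andP[_ tH] := arc_ends (subsetP FH _ aF).
    have : a \in [set b in F | tgt H b == tgt H a] by rewrite inE aF eqxx.
    by have /eqP := degF _ tH; rewrite muln0 cards_eq0 => /eqP->; rewrite inE.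
  by exists (fun=> set0); split; [split => [[]//|]; rewrite big_ord0 | case].
have [T [sTF _ _ degT [cutT cutR]]] := arborescence_ex FH cutF.
have degFT v : indeg H F v = indeg H T v + indeg H (F :\: T) v.
  rewrite !card_indeg (big_setID T) /=; congr (_ + _).
  by rewrite (setIidPr sTF).
have [||T' [[dT' FT'] arbT']] := IH (F :\: T) _ _ cutR.
- exact: subset_trans (subsetDl _ _) FH.
- move=> v vH; have := degFT v; rewrite degF // degT inW vH andbT.
  by case: (v != r) => //; rewrite !mul1n add1n => -[].
exists (fun i => if unlift ord0 i is Some j then T' j else T); split.
  have dTT' j : [disjoint T & T' j].
    rewrite disjoint_sym disjoints_subset; apply/subsetP => a aj.
    have : a \in F :\: T by rewrite FT'; apply/bigcupP; exists j.
    by rewrite !inE => /andP[].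
  split=> [i j|].
    case: unliftP => [i' ->|->]; case: unliftP => [j' ->|->] //.
    - by rewrite (inj_eq lift_inj); apply: dT'.
    by move=> _; rewrite disjoint_sym.
  rewrite big_ord_recl unlift_none.
  under eq_bigr do rewrite liftK.
  by rewrite -FT' -{1}(setID F T) (setIidPr sTF).
move=> i; case: unliftP => // _.
apply: rooted_arborescence_cut => //.
- exact: subset_trans sTF FH.
- by move=> v _; rewrite degT leq_b1.
- by rewrite degT inW eqxx.
- move=> X XH X0 rX; apply: cutT => //; apply/subsetP => x xX.
  by rewrite inW (subsetP XH) // andbT; apply: contraNneq rX => <-.
Qed.

End Edmonds.

(** * Arc counts under intersection, swaps and splicing *)

Section ArcCounts.
Variables (N E : finType) (H : digraph N E).
Implicit Types (F B : {set E}) (X Y Z : {set N}).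

Lemma inside_setI X Z a : inside H (X :&: Z) a = inside H X a && inside H Z a.
Proof. by rewrite /inside !inE; do 4!case: (_ \in _). Qed.

Lemma arcs_within0 F : #|arcs_within H F set0| = 0.
Proof. by rewrite card_arcs_within big1 // => a _; rewrite /inside !inE. Qed.

Lemma arcs_within_supermod F X Z :
  #|arcs_within H F X| + #|arcs_within H F Z| <=
  #|arcs_within H F (X :&: Z)| + #|arcs_within H F (X :|: Z)|.
Proof.
rewrite !card_arcs_within -!big_split; apply: leq_sum => a _.
by rewrite /inside !inE; do 4!case: (_ \in _).
Qed.

Lemma card_swap_within B X (a b : E) : a \notin B -> b \in B ->
  #|arcs_within H (a |: (B :\ b)) X| + inside H X b =
  #|arcs_within H B X| + inside H X a.
Proof.
move=> aB bB; rewrite !card_arcs_within big_setU1 /=; last first.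
  by rewrite inE (negPf aB) andbF.
by rewrite [in RHS](big_setD1 b) //=; lia.
Qed.

Lemma card_swap_indeg B (a b : E) w : a \notin B -> b \in B ->
  indeg H (a |: (B :\ b)) w + (tgt H b == w) = indeg H B w + (tgt H a == w).
Proof.
move=> aB bB; rewrite !card_indeg big_setU1 /=; last first.
  by rewrite inE (negPf aB) andbF.
by rewrite [in RHS](big_setD1 b) //=; lia.
Qed.

Lemma indeg_lt_ex F1 F2 u : indeg H F1 u < indeg H F2 u ->
  exists2 a, a \in F2 :\: F1 & tgt H a = u.
Proof.
move=> ltu; have /subsetPn[a] : ~~ ([set a in F2 | tgt H a == u] \subset
    [set a in F1 | tgt H a == u]).
  by apply: contraL ltu => /subset_leq_card; rewrite -leqNgt.
rewrite !inE => /andP[aF2 /eqP au]; rewrite au eqxx andbT => aF1.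
by exists a; rewrite // inE aF1.
Qed.

Definition splice B1 B2 (P : pred E) : {set E} :=
  [set a | if P a then a \in B1 else a \in B2].

(** The splice and [B2] differ only on arcs inside [Z]; the sum form avoids truncated
    subtraction. *)
Lemma card_splice_within B1 B2 X Z :
  #|arcs_within H (splice B1 B2 (inside H Z)) X| + #|arcs_within H B2 (X :&: Z)| =
  #|arcs_within H B1 (X :&: Z)| + #|arcs_within H B2 X|.
Proof.
rewrite !card_arcs_within ![\sum_(a in _) _]big_mkcond -!big_split /=.
apply: eq_bigr => a _; rewrite inE inside_setI.
by case: (inside H X a); case: (inside H Z a); do 2!case: (_ \in _).
Qed.

End ArcCounts.

(** * Exchange in a face of the count matroid *)

Section TightSparse.
Variables (N E : finType) (H : digraph N E) (k : nat) (W : {set N}).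
Variable K : {set {set N}}.
Implicit Types (F B : {set E}) (X Y Z : {set N}).

(** The count condition of Nash-Williams for a union of [k] forests, with [k] on the left to avoid
    truncated subtraction. *)
Definition sparse F : Prop := forall X, X \subset W -> X != set0 ->
  #|arcs_within H F X| + k <= k * #|X|.

Definition tight_base B : Prop :=
  [/\ B \subset arcs_within H (arcs H) W, sparse B &
      forall Y, Y \in K -> #|arcs_within H B Y| + k = k * #|Y|].

(** Uncrossing: the arc count is supermodular and [k * #|X|] modular, so equality for [X] and [Z]
    leaves no slack in the sparsity bounds for their intersection and union. *)
Lemma sparse_tightI F X Z : sparse F -> X \subset W -> Z \subset W ->
    X :&: Z != set0 ->
    #|arcs_within H F X| + k = k * #|X| -> #|arcs_within H F Z| + k = k * #|Z| ->
  #|arcs_within H F (X :&: Z)| + k = k * #|X :&: Z|.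
Proof.
move=> spF XW ZW XZ0 tX tZ.
have := spF _ (subset_trans (subsetIl X Z) XW) XZ0.
have XZW : X :|: Z \subset W by rewrite subUset XW.
have U0 : X :|: Z != set0.
  have /set0Pn[x] := XZ0; rewrite inE => /andP[xX _].
  by apply/set0Pn; exists x; rewrite inE xX.
have := spF _ XZW U0; have := arcs_within_supermod H F X Z.
have /(congr1 (muln k)) := cardsUI X Z; rewrite !mulnDr.
by lia.
Qed.

Hypothesis lamK : laminar K.
Hypothesis KW : forall Y, Y \in K -> Y \subset W.

(** By supermodularity [B2] has at most as many arcs in [X] beyond those in [X :&: Z] as in
    [X :|: Z] beyond those in [Z]. Tightness of [Z] for [B2] and sparsity of [B1] on [X :&: Z] then
    bound the splice. By laminarity a member of [K] meets [Z] in the empty set or in a member of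
    [K], so the equalities survive. *)
Lemma tight_base_splice B1 B2 Z : tight_base B1 -> tight_base B2 -> Z \in K ->
  tight_base (splice B1 B2 (inside H Z)).
Proof.
move=> [sB1 sp1 t1] [sB2 sp2 t2] ZK; split.
- apply/subsetP => a; rewrite inE.
  by case: ifP => _; [apply: (subsetP sB1) | apply: (subsetP sB2)].
- move=> X XW X0; have := card_splice_within H B1 B2 X Z.
  have [XZ0|XZ0] := eqVneq (X :&: Z) set0.
    by rewrite XZ0 !arcs_within0 addn0 add0n => ->; apply: sp2.
  have XZW : X :&: Z \subset W by apply: subset_trans (subsetIl X Z) XW.
  have XUW : X :|: Z \subset W by rewrite subUset XW KW.
  have U0 : X :|: Z != set0.
    have /set0Pn[x] := X0 => xX.
    by apply/set0Pn; exists x; rewrite inE xX.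
  have := sp1 _ XZW XZ0; have := sp2 _ XUW U0; have := t2 _ ZK.
  have := arcs_within_supermod H B2 X Z.
  have /(congr1 (muln k)) := cardsUI X Z; rewrite !mulnDr.
  by lia.
- move=> Y YK; have := card_splice_within H B1 B2 Y Z.
  have [YZ0|YZ0] := eqVneq (Y :&: Z) set0.
    by rewrite YZ0 !arcs_within0 addn0 add0n => ->; apply: t2.
  have YZK : Y :&: Z \in K.
    have /or3P[/setIidPl->|/setIidPr->|] // := lamK YK ZK.
    by rewrite -setI_eq0 (negPf YZ0).
  by have := t1 _ YZK; have := t2 _ YZK; have := t2 _ YK; lia.
Qed.

Lemma tight_base_splice_seq B1 B2 (s : seq {set N}) :
    tight_base B1 -> tight_base B2 -> {subset s <= K} ->
  tight_base (splice B1 B2 (fun a => has (fun Z => inside H Z a) s)).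
Proof.
move=> b1 b2; elim: s => [|Z s IH] sK.
  have -> // : splice B1 B2 (fun a => has (fun Z => inside H Z a) [::]) = B2.
  by apply/setP => a; rewrite inE.
have sK' : {subset s <= K} by move=> Y Ys; apply: sK; rewrite inE Ys orbT.
have ZK : Z \in K by apply: sK; rewrite inE eqxx.
have := tight_base_splice b1 (IH sK') ZK; congr tight_base.
by apply/setP => a; rewrite !inE /=; case: (inside H Z a).
Qed.

Hypothesis WK : W \in K.

(* Members of [K] not spanning [a] must keep their arcs, so the removed arc is
   sought outside of them: [B2] is first made to agree with [B1] there, and
   then counted on the minimal [B1]-tight set [T] spanning [a]. *)
Lemma tight_base_exchange B1 B2 a : tight_base B1 -> tight_base B2 ->
  a \in B2 :\: B1 -> exists2 b, b \in B1 :\: B2 & tight_base (a |: (B1 :\ b)).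
Proof.
move=> b1 b2; rewrite inE => /andP[aB1 aB2].
have [sB1 sp1 t1] := b1; have [sB2 sp2 t2] := b2.
pose tightB1 X := [&& X \subset W, inside H X a & #|arcs_within H B1 X| + k == k * #|X|].
have aW : inside H W a by have := subsetP sB2 _ aB2; rewrite inE => /andP[].
have tW : tightB1 W by rewrite /tightB1 subxx aW t1 ?eqxx.
case: (arg_minnP (fun X : {set N} => #|X|) tW) => T /and3P[TW aT /eqP tT] minT.
(* Tight sets spanning [a] are closed under intersection, so a smallest one lies in all of them. *)
have TX X : tightB1 X -> T \subset X.
  move=> /and3P[XW aX /eqP tX].
  have aXT : inside H (T :&: X) a by rewrite inside_setI aT.
  have TX0 : T :&: X != set0 by apply/set0Pn; exists (src H a); case/andP: aXT.
  have tTX : tightB1 (T :&: X).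
    apply/and3P; split=> //; first exact: subset_trans (subsetIl T X) TW.
    by apply/eqP; apply: sparse_tightI.
  by apply/setIidPl/eqP; rewrite eqEcard subsetIl minT.
pose s := [seq Z <- enum K | ~~ inside H Z a].
have sK : {subset s <= K} by move=> Z; rewrite mem_filter mem_enum => /andP[].
have [_ spR _] := tight_base_splice_seq b1 b2 sK.
set R := splice _ _ _ in spR.
have T0 : T != set0 by apply/set0Pn; exists (src H a); case/andP: aT.
have aR : a \in R.
  rewrite inE ifN //; apply/hasPn => Z; rewrite mem_filter => /andP[//].
(* Otherwise [R] would contain all arcs of [B1] inside the tight set [T] and also [a], one arc too
   many. *)
have : ~~ (arcs_within H B1 T \subset R).
  apply/negP => sub; have := spR _ TW T0; rewrite -tT leq_add2r leqNgt.
  move/negP; apply; apply: proper_card; rewrite properE; apply/andP; split.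
    apply/subsetP => b bT; rewrite inE (subsetP sub) //.
    by move: bT; rewrite inE => /andP[].
  by apply/subsetPn; exists a; rewrite inE ?aR ?(negPf aB1).
case/subsetPn => b; rewrite inE => /andP[bB1 bT].
(* As [b] is in [B1] but not in [R], no member of [s] spans it; there [R] agrees with [B2], so [b]
   is not in [B2]. *)
rewrite inE; case: ifPn => [|/hasPn bs bB2]; first by rewrite bB1.
exists b; first by rewrite inE bB2.
have inT X : inside H T b -> T \subset X -> inside H X b.
  by move=> /andP[sb tb] /subsetP sTX; rewrite /inside !sTX.
split.
- apply/subsetP => e; rewrite !inE => /orP[/eqP->|/andP[_ eB]].
    by have := subsetP sB2 _ aB2; rewrite !inE.
  by have := subsetP sB1 _ eB; rewrite !inE.
(* Only a tight set spanning [a] is at risk, and it contains [T], so it loses [b] in return. *)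
- move=> X XW X0; have := card_swap_within H X aB1 bB1; have := sp1 _ XW X0.
  rewrite leq_eqVlt => /orP[/eqP tX|ltX] eqX.
    have [aX|naX] := boolP (inside H X a).
      have bX : inside H X b by apply: (inT _ bT); apply: TX; rewrite /tightB1 XW aX tX eqxx.
      by move: eqX; rewrite aX bX => /addIn ->; rewrite tX.
    by move: eqX; rewrite (negPf naX) addn0 -tX leq_add2r => <-; apply: leq_addr.
  apply: leq_trans ltX; rewrite -addSn leq_add2r -addn1.
  apply: leq_trans (leq_addr (inside H X b) _) _.
  by rewrite eqX leq_add2l leq_b1.
(* A member of [K] spanning [a] contains [T] and so spans [b]; any other is in [s] and spans neither
   arc. *)
- move=> Y YK; have := card_swap_within H Y aB1 bB1; rewrite -(t1 _ YK).
  have [aY|naY] := boolP (inside H Y a).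
    have -> : inside H Y b.
      by apply: (inT _ bT); apply: TX; rewrite /tightB1 KW // aY t1 ?eqxx.
    by move/addIn->.
  have /bs/negPf-> : Y \in s by rewrite mem_filter naY mem_enum.
  by rewrite !addn0 => ->.
Qed.

(* If the arc leaving [B1] points to a node [w] where [B1] has no excess over
   [B2], the exchange is continued at [w] with a base closer to [B2]. *)
Lemma indeg_exchange B1 B2 u : tight_base B1 -> tight_base B2 ->
    indeg H B1 u < indeg H B2 u ->
  exists v B, [/\ indeg H B2 v < indeg H B1 v, tight_base B &
    forall w, indeg H B w + (v == w) = indeg H B1 w + (u == w)].
Proof.
have [n] := ubnP #|B1 :\: B2|; elim: n B1 u => // n IH B1 u lt_n b1 b2 ltu.
have [a aD tau] := indeg_lt_ex ltu.
have [b bD bB'] := tight_base_exchange b1 b2 aD.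
move: (aD) (bD); rewrite !inE => /andP[aB1 aB2] /andP[bB2 bB1].
have dB' w := card_swap_indeg H w aB1 bB1; rewrite tau in dB'.
set B' := a |: (B1 :\ b) in bB' dB'.
have lt_n' : #|B' :\: B2| < n.
  apply: (@leq_trans #|B1 :\: B2|) => //; apply: proper_card.
  rewrite properE; apply/andP; split.
    apply/subsetP => e; rewrite !inE => /andP[eB2 /orP[/eqP ea|/andP[_ ->]]].
      by rewrite ea aB2 in eB2.
    by rewrite eB2.
  apply/subsetPn; exists b; rewrite // !inE eqxx bB2 /= orbF.
  by apply: contraNneq aB1 => <-.
clearbody B'; move: (tgt H b) dB' => w dB'.
have [ltw|lew] := ltnP (indeg H B2 w) (indeg H B1 w); first by exists w, B'.
(* Either [w] is [u], where the swap changes nothing and [B1] was short, or [w] has lost an arc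
   without having had an excess. *)
have ltw : indeg H B' w < indeg H B2 w.
  have := dB' w; rewrite eqxx; have [<-|_] := eqVneq u w; lia.
have [v [B [ltv bB dB]]] := IH B' w lt_n' bB' b2 ltw.
have uv : (w == v) = false.
  by apply/negP => /eqP e; move: ltw ltv; rewrite e; lia.
exists v, B; split=> //; last by move=> x; rewrite dB dB'.
have := dB' v; rewrite uv; have [e|_] := eqVneq u v; last by lia.
by move: ltu ltv; rewrite e; lia.
Qed.

End TightSparse.

(** * Counting in [k]-arborescences *)

Lemma sum_ord_const k n : \sum_(i < k) n = k * n.
Proof. by rewrite sum_nat_const card_ord. Qed.

(** Turns exact totals into exact terms, for in-degrees and for the arcs with which each
    arborescence enters a tight set. *)
Lemma eq_leq_sum (I : finType) (P : pred I) (f g : I -> nat) :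
    (forall i, P i -> f i <= g i) -> \sum_(i | P i) f i = \sum_(i | P i) g i ->
  forall i, P i -> f i = g i.
Proof.
move=> le_fg eq_fg i Pi.
have [_] := leqif_sum (fun i Pi => leqif_eq (le_fg i Pi)).
by rewrite eq_fg eqxx => /esym/forall_inP/(_ i Pi)/eqP.
Qed.

Section KArborescences.
Variables (N E : finType) (H : digraph N E) (k : nat).
Implicit Types (F I T : {set E}) (X Y : {set N}).

Lemma card_disjoint_union F (T : 'I_k -> {set E}) (P : pred E) :
  disjoint_union F T -> #|[set a in F | P a]| = \sum_i #|[set a in T i | P a]|.
Proof.
move=> [dT ->]; rewrite card_sep_sum partition_disjoint_bigcup //.
  by apply: eq_bigr => i _; rewrite card_sep_sum.
Qed.

Lemma k_arborescence_indeg F v : k_arborescence k H F -> v \in nodes H ->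
  indeg H F v <= k.
Proof.
move=> [T [dT aT]] vH; rewrite /indeg (card_disjoint_union _ dT).
rewrite -[leqRHS]muln1 -sum_ord_const; apply: leq_sum => i _.
by have [_] := aT i; apply.
Qed.

Lemma k_arborescence_sparse F X : k_arborescence k H F ->
    X \subset nodes H -> X != set0 ->
  #|arcs_within H F X| + k <= k * #|X|.
Proof.
move=> [T [dT aT]] XH X0; rewrite /arcs_within (card_disjoint_union _ dT).
rewrite -[X in _ + X]muln1 -!sum_ord_const -big_split.
apply: leq_sum => i _; rewrite /= addn1.
exact: arborescence_within_lt (aT i) XH X0.
Qed.

Lemma card_k_arborescence F : k_arborescence k H F -> #|F| + k = k * #|nodes H|.
Proof.
move=> [T [dT aT]]; have := card_disjoint_union predT dT.
have setT_id (A : {set E}) : [set a in A | predT a] = A.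
  by apply/setP => a; rewrite inE andbT.
rewrite setT_id => ->; rewrite -[X in _ + X]muln1 -!sum_ord_const -big_split.
apply: eq_bigr => i _ /=.
by rewrite setT_id addn1 (card_arborescence (aT i)).
Qed.

Lemma k_arborescence_nodes F : 0 < k -> k_arborescence k H F -> nodes H != set0.
Proof. by move=> k0 [T [_ aT]]; have [[]] := aT (Ordinal k0). Qed.

Lemma k_arborescence_sub F : k_arborescence k H F -> F \subset arcs H.
Proof.
by move=> [T [[_ ->] aT]]; apply/bigcupsP => i _; have [[]] := aT i.
Qed.

Lemma rooted_k_arborescenceW r F :
  rooted_k_arborescence k H r F -> k_arborescence k H F.
Proof. by move=> [T [dT aT]]; exists T; split=> // i; have [] := aT i. Qed.

Lemma rooted_k_arborescence_root r F : rooted_k_arborescence k H r F ->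
  indeg H F r = 0.
Proof.
move=> [T [dT aT]]; rewrite /indeg (card_disjoint_union _ dT) big1 // => i _.
by have [] := aT i.
Qed.

(** The root has in-degree zero and all others at most [k], while their sum, the number of arcs, is
    [k] times the number of other nodes. *)
Lemma rooted_k_arborescence_indeg r F v : r \in nodes H ->
    rooted_k_arborescence k H r F -> v \in nodes H ->
  indeg H F v = (v != r) * k.
Proof.
move=> rH rF vH; have kF := rooted_k_arborescenceW rF.
have [->|vr] := eqVneq v r; first by rewrite (rooted_k_arborescence_root rF).
have sF := k_arborescence_sub kF; rewrite mul1n.
apply: (eq_leq_sum (P := mem (nodes H :\ r)) (f := indeg H F) (g := fun=> k)).
- by move=> u; rewrite !inE => /andP[_]; apply: k_arborescence_indeg.
- apply/eqP; rewrite sum_nat_const -(eqn_add2r k) mulnC; apply/eqP.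
  have := card_k_arborescence kF; rewrite (cardsD1 r (nodes H)) rH mulnDr muln1.
  rewrite [RHS]addnC => <-; congr (_ + k).
  have := sum_indeg H F (nodes H); have -> : entering H F (nodes H) = set0.
    apply/setP => a; rewrite !inE /enters; apply/negP => /and3P[/(subsetP sF)].
    by move/arc_ends/andP => [->].
  have -> : arcs_within H F (nodes H) = F.
    apply/setP => a; rewrite inE andb_idr // => /(subsetP sF); apply: arc_ends.
  by rewrite (big_setD1 r) //= (rooted_k_arborescence_root rF) cards0.
- by rewrite !inE vr.
Qed.

End KArborescences.

(** The in-degrees over [X] sum to [#|X|], but fewer than [#|X|] arcs lie inside [X]. *)
Lemma rooted_arborescence_enters (N E : finType) (H : digraph N E) (r : N)
    (T : {set E}) (X : {set N}) :
    rooted_arborescence H r T -> X \subset nodes H :\ r -> X != set0 ->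
  0 < #|entering H T X|.
Proof.
move=> aT XW X0; have [sT rH _] := aT.
have rT : rooted_k_arborescence 1 H r T.
  exists (fun=> T); split=> //; split; last by rewrite big_ord1.
  by move=> i j; rewrite !ord1 eqxx.
have XH : X \subset nodes H := subset_trans XW (subsetDl _ _).
rewrite -(ltn_add2r #|arcs_within H T X|) add0n -sum_indeg.
rewrite (eq_bigr (fun=> 1)) ?sum1_card ?(arborescence_within_lt sT) //.
move=> v /(subsetP XW); rewrite !inE => /andP[vr vH].
by rewrite (rooted_k_arborescence_indeg rH rT vH) vr.
Qed.

(* An arborescence entering [Y] only once restricts to one of [Y], rooted at the
   head of the entering arc. *)
Lemma induced_arborescence (N E : finType) (H : digraph N E) (r : N)
    (T : {set E}) (Y : {set N}) :
    rooted_arborescence H r T -> Y \subset nodes H :\ r ->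
    #|entering H T Y| = 1 ->
  spanning_arborescence (induced H Y) (arcs_within H T Y).
Proof.
move=> aT YW /eqP/cards1P[a0 ea0].
have YH : Y \subset nodes H := subset_trans YW (subsetDl _ _).
have [[[sT _ _ _] le1] _ _] := aT; have inj := tgt_inj_in sT le1.
have /andP[a0T /andP[sa0 ta0]] : (a0 \in T) && enters H Y a0.
  by have := set11 a0; rewrite -ea0 inE.
have [] : rooted_arborescence (induced H Y) (tgt H a0) (arcs_within H T Y) => //.
apply: rooted_arborescence_cut.
- by apply/subsetP => a; rewrite !inE => /andP[/(subsetP sT)-> ->].
- by rewrite inE (subsetP YH).
- move=> v; rewrite inE => /andP[vH _]; apply: leq_trans (le1 v vH).
  by apply/subset_leq_card/subsetP => a; rewrite !inE => /andP[/andP[-> _] ->].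
- apply/eqP; rewrite cards_eq0; apply/eqP/setP => a; rewrite !inE.
  apply/negP => /andP[/and3P[aT' sa _] /eqP /(inj _ _ aT' a0T) ea].
  by rewrite ea (negPf sa0) in sa.
move=> X; rewrite subsetI => /andP[XH XY] X0 a0X.
have := rooted_arborescence_enters aT (subset_trans XY YW) X0.
rewrite card_gt0 => /set0Pn[a]; rewrite inE => /andP[aT' /andP[sa ta]].
have tY := subsetP XY _ ta; exists a; last by rewrite /enters /= sa.
rewrite inE aT' tY andbT /=; apply: contraNT a0X => sY.
have : a \in entering H T Y by rewrite inE aT' /enters sY.
by rewrite ea0 inE => /eqP <-.
Qed.


(** * Root arc sets and their exchange property *)

Section Rooted.
Variables (N E : finType) (H : digraph N E) (k : nat) (r : N).
Variable K : {set {set N}}.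
Hypothesis rH : r \in nodes H.
Hypothesis lamK : laminar K.
Hypothesis WK : nodes H :\ r \in K.
Hypothesis KW : forall Y, Y \in K -> Y \subset nodes H :\ r.
Hypothesis K0 : forall Y, Y \in K -> Y != set0.
Implicit Types (F I T : {set E}) (X Y : {set N}).

Lemma subW X : X \subset nodes H :\ r -> X \subset nodes H /\ r \notin X.
Proof.
move=> XW; split; first exact: subset_trans XW (subsetDl _ _).
by apply/negP => /(subsetP XW); rewrite !inE eqxx.
Qed.

(** [BW] for an arbitrary digraph, root and family of node sets; [BW] is the instance [DW k D W],
    [None], [restr L W]. *)
Definition root_bases I : Prop :=
  [/\ I \subset delta_out H r, #|I| = k &
      exists F, [/\ I \subset F, rooted_k_arborescence k H r F & tight k H K F]].

Lemma delta_out_entering F : F \subset delta_out H r ->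
  {in F, forall a, enters H (nodes H :\ r) a}.
Proof.
move=> sF a /(subsetP sF); rewrite !inE => /and3P[/arc_ends/andP[_ tH] /eqP sr tr].
by rewrite /enters !inE sr eqxx tr.
Qed.

(** Forwards, [B] is the set of arcs of [F] avoiding the root. Backwards, [I :|: B] has in-degree
    [k] off the root, so sparsity of [B] is the cut condition of Edmonds' theorem. A set in [K] is
    entered exactly [k] times, hence once by each arborescence, and so each restricts to it. *)
Lemma root_basesP I : root_bases I <-> I \subset delta_out H r /\
  exists2 B, tight_base H k (nodes H :\ r) K B &
    forall v, v \in nodes H :\ r -> indeg H I v + indeg H B v = k.
Proof.
split=> [[sI cI [F [sIF rF tF]]]|[sI [B bB dB]]].
  split=> //; exists (arcs_within H F (nodes H :\ r)).
    have kF := rooted_k_arborescenceW rF; have sF := k_arborescence_sub kF.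
    have wX X : X \subset nodes H :\ r ->
        #|arcs_within H (arcs_within H F (nodes H :\ r)) X| = #|arcs_within H F X|.
      move=> XW; apply: eq_card => a; rewrite !inE.
      case aX: (_ && (tgt H a \in X)); rewrite ?andbF // !andbT.
      move: aX => /andP[/(subsetP XW) + /(subsetP XW)]; rewrite !inE => -> ->.
      by rewrite !andbT.
    split=> [|X XW X0|Y YK].
    - by apply/subsetP => a; rewrite !inE => /andP[/(subsetP sF)-> ->].
    - rewrite wX //; apply: k_arborescence_sparse => //.
      by have [] := subW XW.
    - rewrite wX ?KW //; have := card_k_arborescence (tF _ YK).
      rewrite /=; have [YH _] := subW (KW YK).
      by rewrite (setIidPr YH).
  have cE : #|entering H F (nodes H :\ r)| = k.
    have := sum_indeg H F (nodes H :\ r).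
    rewrite (eq_bigr (fun=> k)); last first.
      move=> v; rewrite !inE => /andP[vr vH]; rewrite (rooted_k_arborescence_indeg rH rF vH) vr mul1n //.
    rewrite sum_nat_const mulnC.
    have := card_k_arborescence (tF _ WK); rewrite /=.
    rewrite (setIidPr (subsetDl _ _)) => <-; rewrite addnC => /addIn -> //.
  (* [F] has exactly [k] root arcs, so [I] consists of all of them. *)
  have eI : I = entering H F (nodes H :\ r).
    apply/eqP; rewrite eqEcard cE cI leqnn andbT; apply/subsetP => a aI.
    by rewrite inE (subsetP sIF) // (delta_out_entering sI).
  move=> v vW; have := vW; rewrite !inE => /andP[vr vH].
  have := rooted_k_arborescence_indeg rH rF vH; rewrite vr mul1n => <-.
  rewrite eI !card_indeg.
  rewrite ![\sum_(a in _) _]big_mkcond -big_split /=; apply: eq_bigr => a _.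
  rewrite !inE /enters; case: (a \in F) => //=.
  case: eqVneq => [->|_]; last by rewrite !if_same.
  by rewrite !inE vr vH !andbT; case: (_ && _).
have [sB spB tB] := bB.
have wI X : X \subset nodes H :\ r -> #|arcs_within H I X| = 0.
  move=> /subW[_ rX]; apply/eqP; rewrite cards_eq0; apply/eqP/setP => a; rewrite !inE.
  apply/negP => /andP[/(subsetP sI) + /andP[+ _]]; rewrite inE => /and3P[_ /eqP-> _].
  by rewrite (negPf rX).
have dIB : [disjoint I & B].
  rewrite disjoints_subset; apply/subsetP => a aI; rewrite inE; apply/negP => aB.
  have := subsetP sB _ aB; rewrite inE => /andP[_ /andP[]].
  by have := delta_out_entering sI aI; rewrite /enters => /andP[/negPf->].
pose F := I :|: B.
have sumU (f : E -> nat) :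
    \sum_(a in F) f a = \sum_(a in I) f a + \sum_(a in B) f a.
  by rewrite -bigU //; apply: eq_bigl => a; rewrite !inE.
have degF v : indeg H F v = indeg H I v + indeg H B v.
  by rewrite !card_indeg sumU.
have wF X : X \subset nodes H :\ r -> #|arcs_within H F X| = #|arcs_within H B X|.
  move=> XW; by rewrite !card_arcs_within sumU -card_arcs_within wI.
have sFH : F \subset arcs H.
  rewrite subUset; apply/andP; split; apply/subsetP => a.
    by move/(subsetP sI); rewrite inE => /andP[].
  by move/(subsetP sB); rewrite inE => /andP[].
have degFv v : v \in nodes H -> indeg H F v = (v != r) * k.
  move=> vH; have [->|vr] := eqVneq v r; last by rewrite degF mul1n dB // !inE vr.
  apply/eqP; rewrite cards_eq0; apply/eqP/setP => a; rewrite !inE.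
  apply/negP => /andP[/orP[/(subsetP sI)|/(subsetP sB)] + /eqP ar].
    by rewrite !inE ar eqxx !andbF.
  by rewrite !inE ar eqxx !andbF.
have entF X : X \subset nodes H :\ r ->
    #|entering H F X| + #|arcs_within H B X| = k * #|X|.
  move=> XW; rewrite -(wF X XW) -sum_indeg mulnC -sum_nat_const.
  apply: eq_bigr => v /(subsetP XW); rewrite !inE => /andP[vr vH].
  by rewrite degFv // vr mul1n.
have rF : rooted_k_arborescence k H r F.
  apply: edmonds_disjoint_arborescences => // X XW X0.
  by have := spB _ XW X0; rewrite -(entF X XW) addnC leq_add2r.
split=> //.
  have := entF _ (subxx _); rewrite -(tB _ WK) addnC => /addnI <-.
  apply: eq_card => a; rewrite !inE.
  apply/idP/andP => [aI|[/orP[//|/(subsetP sB)]]].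
    by rewrite aI (delta_out_entering sI).
  by rewrite inE => /andP[_ /andP[sa _]] /andP[]; rewrite sa.
exists F; split=> //; first exact: subsetUl.
move=> Y YK; have [YH rY] := subW (KW YK).
have [T [dT aT]] := rF.
exists (fun i => arcs_within H (T i) Y); split.
  split=> [i j ij|].
    rewrite -setI_eq0 -subset0 -(eqP (_ : T i :&: T j == set0)).
      by apply: setISS; apply/subsetP => a; rewrite inE => /andP[].
    by rewrite setI_eq0 dT.1.
  apply/setP => a; rewrite inE dT.2; apply/andP/bigcupP.
    by move=> [/bigcupP[i _ aTi] aY]; exists i; rewrite // inE aTi.
  by move=> [i _]; rewrite inE => /andP[aTi aY]; split=> //; apply/bigcupP; exists i.
move=> i; apply: induced_arborescence (aT i) (KW YK) _.
apply/esym; move: i (isT : predT i).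
apply: eq_leq_sum => [i _|].
  exact: rooted_arborescence_enters (aT i) (KW YK) (K0 YK).
rewrite /= sum_ord_const muln1.
rewrite -(card_disjoint_union _ dT); apply/esym/eqP.
by rewrite -(eqn_add2r #|arcs_within H B Y|) [X in X == _](entF _ (KW YK)) -(tB _ YK) addnC.
Qed.

Theorem root_bases_exchange I J x : root_bases I -> root_bases J ->
  x \in I :\: J -> exists2 y, y \in J :\: I & root_bases (y |: (I :\ x)).
Proof.
move=> /root_basesP[sI [B bB dB]] /root_basesP[sJ [C bC dC]] xIJ.
have [xJ xI] : x \notin J /\ x \in I by move: xIJ; rewrite inE => /andP[].
have tW a : a \in I :|: J -> tgt H a \in nodes H :\ r.
  by rewrite inE => /orP[/(delta_out_entering sI)|/(delta_out_entering sJ)] /andP[].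
have xW : tgt H x \in nodes H :\ r by apply: tW; rewrite inE xI.
(* Swapping [x] for [y] in [I] is compensated when [B'] has one arc more than [B] into the head of
   [x] and one less into that of [y]. *)
have fin y B' : y \in J :\: I -> tight_base H k (nodes H :\ r) K B' ->
    (forall v, indeg H B' v + (tgt H y == v) = indeg H B v + (tgt H x == v)) ->
    root_bases (y |: (I :\ x)).
  rewrite inE => /andP[yI yJ] bB' dB'; apply/root_basesP; split.
    by rewrite subUset sub1set (subsetP sJ) //= (subset_trans (subsetDl _ _) sI).
  exists B' => // v vW; apply/eqP.
  rewrite -(eqn_add2r ((tgt H x == v) + (tgt H y == v))) addnACA.
  by rewrite (card_swap_indeg H v yI xI) dB' addnACA dB // [X in k + X]addnC.
have [lt|le] := ltnP (indeg H B (tgt H x)) (indeg H C (tgt H x)).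
  (* At a node [v] where [B] exceeds [C], [J] has more root arcs than [I], which supplies [y]. *)
  have [v [B' [ltv bB' dB']]] := indeg_exchange lamK KW WK bB bC lt.
  have vW : v \in nodes H :\ r.
    have : 0 < indeg H B v by apply: leq_trans ltv.
    rewrite card_gt0 => /set0Pn[a]; rewrite inE => /andP[aB /eqP <-].
    by have [/subsetP/(_ _ aB)] := bB; rewrite inE => /and3P[].
  have [|y yJI ty] := @indeg_lt_ex _ _ H I J v.
    by have := dB _ vW; have := dC _ vW; lia.
  by exists y => //; apply: fin yJI bB' _ => w; rewrite ty.
(* Here [J] has at least as many root arcs into the head of [x] as [I], so an arc parallel to [x]
   replaces it and [B] is kept. *)
have [|y] := @indeg_lt_ex _ _ H (I :\ x) J (tgt H x).
  have : indeg H I (tgt H x) = (indeg H (I :\ x) (tgt H x)).+1.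
    by rewrite !card_indeg (big_setD1 x) //= eqxx.
  by have := dB _ xW; have := dC _ xW; lia.
rewrite !inE negb_and negbK => /andP[/orP[/eqP->|yI] yJ] ty.
  by rewrite yJ in xJ.
have yJI : y \in J :\: I by rewrite inE yI.
by exists y => //; apply: (fin y B) => // w; rewrite ty.
Qed.

End Rooted.

(** * Root arcs and arc counts in [DW] *)

Lemma card_ord_lt m c : c <= m -> #|[set i : 'I_m | i < c]| = c.
Proof.
move=> le_cm; have -> : [set i : 'I_m | i < c] = [set widen_ord le_cm j | j : 'I_c].
  apply/setP => i; rewrite inE; apply/idP/imsetP => [ltc|[j _ ->] /=] //.
  by exists (Ordinal ltc) => //; apply: val_inj.
by rewrite card_imset ?card_ord // => i j /(congr1 val) /= /val_inj.
Qed.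

Section ContractedPlus.
Variables (N E : finType) (k : nat) (D : digraph N E) (W : {set N}).
Hypothesis WD : W \subset nodes D.
Implicit Types (X Y : {set N}) (F : {set E}).

Let S := plus_nodes D :\: (Some @: W).

Lemma mem_Some X v : (Some v \in Some @: X) = (v \in X).
Proof. by rewrite mem_imset // => ? ? []. Qed.

Lemma None_notin_Some X : (None \in Some @: X) = false.
Proof. by apply/imsetP => -[]. Qed.

Lemma mem_contract_end X v : X \subset W ->
  (contract_end S None (Some v) \in Some @: X) = (v \in X).
Proof.
move=> XW; rewrite /contract_end; case: ifP; last by rewrite mem_Some.
rewrite None_notin_Some inE mem_Some => /andP[vW _].
by apply/esym/negbTE; apply: contraNN vW; apply: (subsetP XW).
Qed.

Lemma contract_end_None : contract_end S None None = None.
Proof. by rewrite /contract_end if_same. Qed.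

Lemma contract_end_eq u v : v \in W ->
  (contract_end S None (Some u) == Some v) = (u == v).
Proof.
move=> vW; rewrite -in_set1 -(imset_set1 Some) mem_contract_end ?sub1set //.
by rewrite in_set1.
Qed.

Lemma nodes_DW : nodes (DW k D W) = None |: (Some @: W).
Proof.
rewrite /= setDDr setDv set0U; congr (_ |: _); apply/setIidPr.
by apply: subset_trans (subsetUr _ _); apply: imsetS.
Qed.

Lemma nodes_DW_root : nodes (DW k D W) :\ None = Some @: W.
Proof. by rewrite nodes_DW setU1K // None_notin_Some. Qed.

Lemma within_DW F X : X \subset W ->
  arcs_within (DW k D W) (inl @: F) (Some @: X) = inl @: arcs_within D F X.
Proof.
move=> XW; apply/setP => -[a|[v i]].
  rewrite inE !(mem_imset _ _ (@inl_inj _ _)) inE /=.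
  by rewrite !mem_contract_end.
rewrite inE; apply/andP/imsetP => [[/imsetP[]]|[]] //.
Qed.

Lemma indeg_DW F v : v \in W ->
  indeg (DW k D W) (inl @: F) (Some v) = indeg D F v.
Proof.
move=> vW; rewrite /indeg -[RHS](card_imset _ (@inl_inj E (N * 'I_(#|arcs D| + k)))).
apply: eq_card => -[a|[u i]].
  by rewrite !(mem_imset _ _ (@inl_inj _ _), inE) /= contract_end_eq.
by rewrite inE; apply/andP/imsetP => [[/imsetP[]]|[]].
Qed.

(** Takes the first [m v] of the parallel arcs from the new node to [v], so as to prescribe
    in-degrees. *)
Definition root_copies (m : N -> nat) : {set plus_arc k D} :=
  [set e : plus_arc k D | if e is inr (v, i) then (v \in W) && (i < m v) else false].

Lemma root_copies_delta m : root_copies m \subset delta_out (DW k D W) None.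
Proof.
apply/subsetP => -[a|[v i]]; rewrite inE // => /andP[vW _].
rewrite inE in_setD 2!inE /= contract_end_None eqxx (subsetP WD) // andbT.
have -> : (contract_end S None (Some v) == None) = false.
  by apply/eqP => e; have := mem_contract_end v (subxx W); rewrite e vW None_notin_Some.
by rewrite [Some v \in _]in_setD mem_Some vW !andbF.
Qed.

Lemma indeg_root_copies m v : v \in W -> m v <= #|arcs D| + k ->
  indeg (DW k D W) (root_copies m) (Some v) = m v.
Proof.
move=> vW /card_ord_lt; have inj : injective (fun i => inr (v, i) : plus_arc k D).
  by move=> i j [].
rewrite -(card_imset _ inj) => <-; apply: eq_card => -[a|[u i]].
  by rewrite !inE /=; apply/esym/imsetP => -[].
rewrite !inE contract_end_eq //; apply/andP/imsetP => [[/andP[_ lt] /eqP eu]|].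
  by exists i; rewrite ?eu // inE -eu.
by move=> [j ltj [-> ->]]; rewrite vW eqxx; split=> //; rewrite inE in ltj.
Qed.

(** The arcs of [F] inside [W] form a [k]-arborescence, so their in-degrees are at most [k]; the
    missing arcs are root copies, of which every node has at least [k]. *)
Lemma root_bases_ex (L : {set {set N}}) F : W \in L -> tight k D L F ->
  exists I : {set plus_arc k D}, I \subset delta_out (DW k D W) None /\
    exists2 B, tight_base (DW k D W) k (Some @: W) (restr L W) B &
    forall v, v \in Some @: W -> indeg (DW k D W) I v + indeg (DW k D W) B v = k.
Proof.
move=> WL tF; pose G := arcs_within D F W.
have kG := tF _ WL; have iW : nodes D :&: W = W by apply/setIidPr.
have GE X : X \subset W -> arcs_within D G X = arcs_within D F X.
  move=> XW; apply/setP => a; rewrite !inE -andbA; congr (_ && _).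
  by rewrite andb_idl // => /andP[/(subsetP XW)-> /(subsetP XW)->].
exists (root_copies (fun v => k - indeg D G v)); split; first exact: root_copies_delta.
exists (inl @: G); last first.
  move=> _ /imsetP[v vW ->]; rewrite indeg_DW // indeg_root_copies //.
    by rewrite subnK //; apply: (k_arborescence_indeg kG); rewrite /= iW.
  by rewrite (leq_trans (leq_subr _ _)) ?leq_addl.
have GD := k_arborescence_sub kG.
split.
- apply/subsetP => _ /imsetP[a aG ->].
  have := subsetP GD _ aG; rewrite inE => /andP[aD /andP[sa ta]].
  by rewrite !inE !mem_contract_end // sa ta aD !mem_Some sa.
- move=> X XW X0.
  (* [X] avoids [None], so it is the image of a set in [N], where the counts of [G] apply. *)
  have eX : X = Some @: [set v | Some v \in X].
    apply/setP => -[v|]; first by rewrite mem_Some inE.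
    rewrite None_notin_Some; apply/negbTE/negP => /(subsetP XW).
    by rewrite None_notin_Some.
  move: X0 XW; rewrite {}eX; move: [set v | _] => Y Y0 YW.
  have sYW : Y \subset W by apply/subsetP => v vY; rewrite -mem_Some (subsetP YW) ?mem_Some.
  rewrite within_DW // (card_imset _ (@inl_inj _ _)) card_imset; last by move=> ? ? [].
  apply: (k_arborescence_sparse kG); first by rewrite /= iW.
  by apply: contraNneq Y0 => ->; rewrite imset0.
- move=> _ /imsetP[Y + ->]; rewrite inE => /andP[YL YW].
  rewrite within_DW // (card_imset _ (@inl_inj _ _)) card_imset; last by move=> ? ? [].
  rewrite GE //; have := card_k_arborescence (tF _ YL).
  by rewrite /= (setIidPr (subset_trans YW WD)).
Qed.

End ContractedPlus.

(** * The matroid of a member of the laminar family *)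

Theorem theorem4p1 (N E : finType) (k : nat) (D : digraph N E)
    (L : {set {set N}})
    (k_gt0 : 0 < k)
    (L_sub : forall X, X \in L -> X \subset nodes D)
    (L_laminar : laminar L)
    (L_full : nodes D \in L)
    (L_single : forall v, v \in nodes D -> [set v] \in L)
    (D_tight : exists F : {set E}, k_arborescence k D F /\ tight k D L F) :
  forall W : {set N}, W \in L ->
    matroid_bases (delta_out (DW k D W) None) (@BW N E k D L W).
Proof.
move=> W WL; have [F [_ tF]] := D_tight; have WD := L_sub _ WL.
(* As [0 < k], a member of [L] induces a digraph with a spanning tree, which is nonempty by
   definition. *)
have L0 X : X \in L -> X != set0.
  move=> XL; have := k_arborescence_nodes k_gt0 (tF _ XL).
  by rewrite /= (setIidPr (L_sub _ XL)).
have rH : None \in nodes (DW k D W) by rewrite setU11.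
have WK : nodes (DW k D W) :\ None \in restr L W.
  by rewrite nodes_DW_root //; apply: imset_f; rewrite inE WL subxx.
have KW Y : Y \in restr L W -> Y \subset nodes (DW k D W) :\ None.
  by rewrite nodes_DW_root // => /imsetP[X + ->]; rewrite inE => /andP[_]; apply: imsetS.
have K0 Y : Y \in restr L W -> Y != set0.
  case/imsetP => X; rewrite inE => /andP[/L0/set0Pn[x xX] _] ->.
  by apply/set0Pn; exists (Some x); apply: imset_f.
have lamK : laminar (restr L W).
  move=> _ _ /imsetP[X + ->] /imsetP[Y + ->].
  rewrite !inE => /andP[XL _] /andP[YL _].
  have /or3P[sXY|sYX|dXY] := L_laminar _ _ XL YL.
  - by rewrite imsetS.
  - by rewrite (imsetS _ sYX) orbT.
  - apply/or3P/Or33; rewrite -setI_eq0 -imsetI; last by move=> ? ? _ _ [].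
    by move: dXY; rewrite -setI_eq0 => /eqP->; rewrite imset0.
split.
- by move=> I [].
- have [I bI] := root_bases_ex WD WL tF; exists I.
  by apply: (root_basesP k rH WK KW K0 I).2; rewrite nodes_DW_root.
- move=> I J bI bJ x; exact: (root_bases_exchange rH lamK WK KW K0 bI bJ).
Qed.
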